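(* There is an algorithm which, given integers $1\le p<n$ and a real partial symmetric $n\times n$ matrix $\bar X$ whose specified entries are exactly those with $|i-j|\le p$ and which has a positive definite completion, computes $\ln\det\hat X$ in $O(np^2)$ operations, where $\hat X$ is the maximum-determinant positive definite completion of $\bar X$ and the constant in $O(\cdot)$ is absolute.
   Context: A partial symmetric matrix is a symmetric matrix in which only some of the entries are specified. A completion of $\bar X$ is a symmetric matrix agreeing with $\bar X$ on all specified entries. Whenever $\bar X$ (with the banded pattern of specified entries $|i-j|\le p$) has a positive definite completion, it has a unique positive definite completion $\hat X$ maximizing the determinant among all positive definite completions. The cost model counts each exact real arithmetic operation ($+,-,\times,\div$), comparison, square root and logarithm as one operation. *)

(* Defs.v *)
From mathcomp Require Import all_boot all_order all_algebra.
From mathcomp Require Import reals exp.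

Set Implicit Arguments.
Unset Strict Implicit.
Unset Printing Implicit Defensive.

Import Order.TTheory GRing.Theory Num.Theory.
Local Open Scope ring_scope.

(* A partial matrix is a matrix over [option R], [None] marking an unspecified
   entry. *)
Definition partial_symmetric (R : realType) (n : nat) (X : 'M[option R]_n) : Prop :=
  X^T = X.

Definition banded_pattern (R : realType) (n p : nat) (X : 'M[option R]_n) : Prop :=
  forall i j : 'I_n, isSome (X i j) = (`|i - j| <= p)%N.

Definition posdef (R : realType) (n : nat) (A : 'M[R]_n) : Prop :=
  A^T = A /\ forall x : 'rV[R]_n, x != 0 -> 0 < (x *m A *m x^T) 0 0.

Definition completion (R : realType) (n : nat) (X : 'M[option R]_n) (Y : 'M[R]_n) : Prop :=
  Y^T = Y /\ forall (i j : 'I_n) (v : R), X i j = Some v -> Y i j = v.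

Definition pd_completion (R : realType) (n : nat) (X : 'M[option R]_n) (Y : 'M[R]_n) : Prop :=
  completion X Y /\ posdef Y.

Definition maxdet_completion (R : realType) (n : nat) (X : 'M[option R]_n) (Y : 'M[R]_n) : Prop :=
  pd_completion X Y /\ forall Z : 'M[R]_n, pd_completion X Z -> \det Z <= \det Y.

(* Algorithms are programs of a finite imperative language for the real RAM.
   A state has natural-number variables (inputs and indices) and
   two-dimensional arrays of reals.  The language has neither arbitrary real
   constants nor conversions from reals to naturals, and its syntax does not
   mention the reals, so that one program serves all dimensions, bandwidths
   and input matrices. *)

Inductive iexp : Type :=
| ILit of nat
| IVar of nat
| IAdd of iexp & iexp
| ISub of iexp & iexp. (* truncated at 0 *)

Inductive rexp : Type :=
| RLit of nat
| RGet of nat & iexp & iexp (* array name, row, column *)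
| RAdd of rexp & rexp
| RSub of rexp & rexp
| RMul of rexp & rexp
| RDiv of rexp & rexp
| RSqrt of rexp
| RLn of rexp.

Inductive test : Type :=
| ILe of iexp & iexp
| RLe of rexp & rexp.

Inductive cmd : Type :=
| Skip
| ISet of nat & iexp
| RSet of nat & iexp & iexp & rexp
| Seq of cmd & cmd
| If of test & cmd & cmd
| While of test & cmd.

Record state (R : realType) : Type := State {
  ivar : nat -> nat;
  arr : nat -> nat -> nat -> R
}.

Definition set_ivar (R : realType) (s : state R) (x v : nat) : state R :=
  State (fun y => if y == x then v else ivar s y) (arr s).

Definition set_arr (R : realType) (s : state R) (a i j : nat) (v : R) : state R :=
  State (ivar s)
    (fun b k l => if [&& b == a, k == i & l == j] then v else arr s b k l).

Fixpoint ieval (R : realType) (s : state R) (e : iexp) : nat :=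
  match e with
  | ILit k => k
  | IVar x => ivar s x
  | IAdd e1 e2 => (ieval s e1 + ieval s e2)%N
  | ISub e1 e2 => (ieval s e1 - ieval s e2)%N
  end.

Fixpoint reval (R : realType) (s : state R) (e : rexp) : R :=
  match e with
  | RLit k => k%:R
  | RGet a i j => arr s a (ieval s i) (ieval s j)
  | RAdd e1 e2 => reval s e1 + reval s e2
  | RSub e1 e2 => reval s e1 - reval s e2
  | RMul e1 e2 => reval s e1 * reval s e2
  | RDiv e1 e2 => reval s e1 / reval s e2
  | RSqrt e1 => Num.sqrt (reval s e1)
  | RLn e1 => ln (reval s e1)
  end.

(* [reval] inherits the library's default values for x / 0, for square roots
   of negative numbers and for logarithms of nonpositive numbers.  An execution
   must never rely on them: a program that evaluates an expression which is not
   [rdefined] is stuck. *)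
Fixpoint rdefined (R : realType) (s : state R) (e : rexp) : bool :=
  match e with
  | RLit _ | RGet _ _ _ => true
  | RAdd e1 e2 | RSub e1 e2 | RMul e1 e2 => rdefined s e1 && rdefined s e2
  | RDiv e1 e2 => [&& rdefined s e1, rdefined s e2 & reval s e2 != 0]
  | RSqrt e1 => rdefined s e1 && (0 <= reval s e1)
  | RLn e1 => rdefined s e1 && (0 < reval s e1)
  end.

Fixpoint rcost (e : rexp) : nat :=
  match e with
  | RLit _ | RGet _ _ _ => 0
  | RAdd e1 e2 | RSub e1 e2 | RMul e1 e2 | RDiv e1 e2 => (rcost e1 + rcost e2).+1
  | RSqrt e1 | RLn e1 => (rcost e1).+1
  end.

Definition teval (R : realType) (s : state R) (t : test) : bool :=
  match t with
  | ILe e1 e2 => (ieval s e1 <= ieval s e2)%N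
  | RLe e1 e2 => reval s e1 <= reval s e2
  end.

Definition tdefined (R : realType) (s : state R) (t : test) : bool :=
  match t with
  | ILe _ _ => true
  | RLe e1 e2 => rdefined s e1 && rdefined s e2
  end.

(* Every comparison costs one operation, including those between indices.
   Index arithmetic and copying are free, but since each loop iteration pays
   for its test, the number of elementary steps of a program is at most a
   constant (depending only on the program) times one plus its cost. *)
Definition tcost (t : test) : nat :=
  match t with
  | ILe _ _ => 1
  | RLe e1 e2 => (rcost e1 + rcost e2).+1
  end.

(* [exec c s s' k]: started in [s], the program [c] halts in [s'] after [k]
   operations. *)
Inductive exec (R : realType) : cmd -> state R -> state R -> nat -> Prop :=
| exec_skip s :
    exec Skip s s 0
| exec_iset s x e :
    exec (ISet x e) s (set_ivar s x (ieval s e)) 0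
| exec_rset s a i j e :
    rdefined s e ->
    exec (RSet a i j e) s (set_arr s a (ieval s i) (ieval s j) (reval s e)) (rcost e)
| exec_seq s1 s2 s3 c1 c2 k1 k2 :
    exec c1 s1 s2 k1 -> exec c2 s2 s3 k2 ->
    exec (Seq c1 c2) s1 s3 (k1 + k2)
| exec_if s s' t c1 c2 k :
    tdefined s t -> exec (if teval s t then c1 else c2) s s' k ->
    exec (If t c1 c2) s s' (tcost t + k)
| exec_while_false s t c :
    tdefined s t -> ~~ teval s t ->
    exec (While t c) s s (tcost t)
| exec_while_true s1 s2 s3 t c k1 k2 :
    tdefined s1 t -> teval s1 t ->
    exec c s1 s2 k1 -> exec (While t c) s2 s3 k2 ->
    exec (While t c) s1 s3 (tcost t + k1 + k2).

Definition input_entry (R : realType) (n : nat) (X : 'M[option R]_n) (i j : nat) : R :=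
  match insub i, insub j with
  | Some i', Some j' => odflt 0 (X i' j')
  | _, _ => 0
  end.

(* Variables 0 and 1 hold n and p, array 0 holds the specified entries of X;
   everything else is 0. *)
Definition init_state (R : realType) (n p : nat) (X : 'M[option R]_n) : state R :=
  State
    (fun x => match x with 0 => n | 1 => p | _ => 0 end%N)
    (fun a i j => if a == 0%N then input_entry X i j else 0).

(* The output is read in cell (0, 0) of array 1. *)
Definition computes (R : realType) (c : cmd) (n p : nat) (X : 'M[option R]_n)
    (v : R) (k : nat) : Prop :=
  exists s : state R, exec c (init_state p X) s k /\ arr s 1 0 0 = v.

(* Main.v *)
(** Let s_k be the minimum of u X u^T over the vectors u supported on
    {k - p, .., k} with u_k = 1; it only involves specified entries.  If U has
    the minimizers u_k as rows, then for every completion Z the diagonal of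
    U Z U^T is (s_k) and det U = 1, so Hadamard's inequality gives
    det Z <= prod_k s_k when Z is positive definite.  Equality is attained by
    Z = U^-1 diag(s) U^-T, which is again a completion.  Hence
    ln det Xhat = sum_k ln s_k.

    To obtain each s_k in O(p^2) operations, maintain the inverse M of the
    window X[k-p..k-1].  Then s_k = X_kk - x^T M x with x the part of column k
    in the window, and both adding index k to the window and dropping index
    k - p are rank-one updates of M. *)

Require Import Defs.
From mathcomp Require Import all_boot all_order all_algebra.
From mathcomp Require Import reals exp.
From mathcomp Require Import zify.

Set Implicit Arguments.
Unset Strict Implicit.
Unset Printing Implicit Defensive.

Import Order.TTheory GRing.Theory Num.Theory.
Local Open Scope ring_scope.

(** * Positive definite matrices *)

Definition qform (R : realType) (n : nat) (A : 'M[R]_n) (u : 'rV[R]_n) : R :=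
  (u *m A *m u^T) 0 0.

Lemma qformE (R : realType) (n : nat) (A : 'M[R]_n) (u : 'rV[R]_n) :
  qform A u = \sum_l (u *m A) 0 l * u 0 l.
Proof. by rewrite /qform mxE; apply: eq_bigr => l _; rewrite [u^T _ _]mxE. Qed.

Lemma posdef_congr (R : realType) (n : nat) (A B : 'M[R]_n) :
  posdef A -> B \in unitmx -> posdef (B *m A *m B^T).
Proof.
move=> [symA posA] uB; split=> [|x nz_x].
  by rewrite !trmx_mul trmxK symA mulmxA.
have := posA (x *m B); rewrite trmx_mul !mulmxA; apply.
by apply: contraNneq nz_x => xB0; rewrite -(mulmxK uB x) xB0 mul0mx.
Qed.

Lemma posdef_diag_mx (R : realType) (n : nat) (d : 'rV[R]_n) :
  (forall i, 0 < d 0 i) -> posdef (diag_mx d).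
Proof.
move=> d_gt0; split=> [|x nz_x]; first by rewrite tr_diag_mx.
have [i xi0] := rV0Pn _ nz_x.
rewrite -/(qform _ _) qformE (bigD1 i) //= ltr_pwDl //.
  rewrite mul_mx_diag mxE mulrAC -expr2 mulr_gt0 ?d_gt0 //.
  by rewrite lt_neqAle sqr_ge0 eq_sym sqrf_eq0 xi0.
apply: sumr_ge0 => j _; rewrite mul_mx_diag mxE mulrAC -expr2.
by rewrite mulr_ge0 ?sqr_ge0 // ltW.
Qed.

Lemma posdef_diag_gt0 (R : realType) (n : nat) (A : 'M[R]_n) (i : 'I_n) :
  posdef A -> 0 < A i i.
Proof.
move=> [_ /(_ (delta_mx 0 i))]; rewrite -rowE trmx_delta -colE !mxE; apply.
by apply/rV0Pn; exists i; rewrite !mxE !eqxx oner_neq0.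
Qed.

(** Induction on the size, splitting off the first index: the determinant is the Schur complement
    [t] of [C] times [\det C]. The quadratic form at [(1, -w)] equals [t], so [t] is positive, and
    [t] is at most [a] because it differs from [a] by the value of [C] at [w]. *)
Lemma hadamard_posdef (R : realType) (n : nat) (A : 'M[R]_n) :
  posdef A -> 0 < \det A <= \prod_i A i i.
Proof.
elim: n A => [|n IHn]; first by move=> A _; rewrite det_mx00 big_ord0 ltr01 lexx.
suff step (A : 'M[R]_(1 + n)) : posdef A -> 0 < \det A <= \prod_i A i i.
  exact: step.
case; rewrite -[A]submxK.
set a := ulsubmx _; set b := ursubmx _; set c := dlsubmx _; set C := drsubmx _.
rewrite tr_block_mx => /eq_block_mx [_ _ bT symC] posA.
have pdC : posdef C.
  split=> // x nz_x; have := posA (row_mx 0 x).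
  rewrite mul_row_block !mul0mx !add0r tr_row_mx trmx0.
  rewrite mul_row_col mulmx0 add0r; apply.
  by apply: contraNneq nz_x => /eqP; rewrite row_mx_eq0 => /andP[].
have /andP[detC leC] := IHn _ pdC.
have uC : C \in unitmx by rewrite unitmxE unitfE gt_eqF.
pose w := b *m invmx C.
have wC : w *m C = b by rewrite mulmxKV.
pose t := a - w *m c.
have detA : \det (block_mx a b c C) = t 0 0 * \det C.
  rewrite -(det_mx11 t) -(det_lblock t c C) -[LHS]mul1r.
  (* Left multiplication by this unipotent matrix subtracts [w] times the lower block row from the
     upper one, which clears [b]. *)
  have <- : \det (block_mx (1%:M : 'M[R]_1) (- w) 0 1%:M) = 1.
    by rewrite det_ublock !det1 mulr1.
  by rewrite -det_mulmx mulmx_block !mul1mx !mul0mx !add0r !mulNmx wC subrr.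
have t_gt0 : 0 < t 0 0.
  have := posA (row_mx 1%:M (- w)).
  rewrite mul_row_block !mul1mx !mulNmx wC subrr.
  rewrite tr_row_mx mul_row_col mul0mx addr0 trmx1 mulmx1; apply.
  rewrite row_mx_eq0 negb_and; apply/orP; left.
  by apply/eqP => /matrixP /(_ 0 0) /eqP; rewrite !mxE oner_eq0.
have t_le : t 0 0 <= a 0 0.
  rewrite [t 0 0]mxE [X in _ + X]mxE gerBl.
  have <- : w *m C *m w^T = w *m c.
    have -> : c = C *m w^T by rewrite -bT -wC trmx_mul symC.
    by rewrite mulmxA.
  case: (eqVneq w 0) => [->|nz_w]; first by rewrite !mul0mx mxE.
  by case: pdC => _ /(_ w nz_w) /ltW.
rewrite detA mulr_gt0 //= big_split_ord big_ord1 ler_pM //; try exact: ltW.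
  by rewrite block_mxEul.
by under eq_bigr do rewrite block_mxEdr.
Qed.

(** * Inverses of principal submatrices *)

(** The inverse of the principal submatrix of [Y] on [W], padded with zeros to full size. This
    avoids reindexing when [W] changes; columns of [M *m Y] outside [W] are left free. *)
Definition window_inverse (R : realType) (n : nat) (Y : 'M[R]_n)
    (W : {set 'I_n}) (M : 'M[R]_n) : Prop :=
  [/\ M^T = M, forall i j, i \notin W -> M i j = 0 &
      forall i l, i \in W -> l \in W -> (M *m Y) i l = (i == l)%:R].

Lemma rank1_mulE (R : realType) (n : nat) (M Y : 'M[R]_n) (v : 'rV[R]_n)
    (a : R) (i l : 'I_n) :
  ((M + a *: (v^T *m v)) *m Y) i l = (M *m Y) i l + a * v 0 i * (v *m Y) 0 l.
Proof.
rewrite mulmxDl -scalemxAl -mulmxA [LHS]mxE; congr (_ + _).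
by rewrite mxE [X in _ * X]mxE big_ord1 [v^T _ _]mxE mulrA.
Qed.

Lemma rank1E (R : realType) (n : nat) (M : 'M[R]_n) (v : 'rV[R]_n)
    (a : R) (i j : 'I_n) :
  (M + a *: (v^T *m v)) i j = M i j + a * v 0 i * v 0 j.
Proof. by rewrite !mxE big_ord1 mxE mulrA. Qed.

Lemma rank1_sym (R : realType) (n : nat) (M : 'M[R]_n) (v : 'rV[R]_n) (a : R) :
  M^T = M -> (M + a *: (v^T *m v))^T = M + a *: (v^T *m v).
Proof. by move=> symM; rewrite linearD linearZ /= trmx_mul trmxK symM. Qed.

(** The update clears row and column [f] of [M]. It leaves the products with the other window
    columns of [Y] unchanged, since row [f] of [M *m Y] vanishes there. The pivot [M f f] is the
    quadratic form of [Y] at row [f] of [M], hence positive. *)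
Lemma window_inverse_remove (R : realType) (n : nat) (Y M : 'M[R]_n)
    (W : {set 'I_n}) (f : 'I_n) :
  posdef Y -> window_inverse Y W M -> f \in W ->
  0 < M f f /\
  window_inverse Y (W :\ f) (M - (M f f)^-1 *: ((row f M)^T *m row f M)).
Proof.
move=> [_ posY] [symM M0 MY] fW.
have M0r i j : j \notin W -> M i j = 0 by move=> jW; rewrite -symM mxE M0.
have vY l : l \in W -> (row f M *m Y) 0 l = (f == l)%:R.
  by move=> lW; rewrite -row_mul mxE MY.
have Mff : 0 < M f f.
  have nz_v : row f M != 0.
    apply/eqP => v0; have := vY f fW; rewrite v0 mul0mx mxE eqxx.
    by move/eqP; rewrite eq_sym oner_eq0.
  have := posY _ nz_v; rewrite -/(qform _ _) qformE (bigD1 f) //= vY // eqxx mul1r.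
  rewrite big1 ?addr0 ?mxE // => l lf; rewrite [row f M 0 l]mxE.
  case: (boolP (l \in W)) => lW; first by rewrite vY // eq_sym (negbTE lf) mul0r.
  by rewrite M0r // mulr0.
split=> //; rewrite -scaleNr; split.
- exact: rank1_sym.
- move=> i j; rewrite in_setD1 negb_and negbK rank1E !mxE.
  have -> : M f i = M i f by rewrite -{1}symM mxE.
  case/orP=> [/eqP->|iW]; last by rewrite !(M0 i) // mulr0 mul0r addr0.
  by rewrite mulNr mulVf ?gt_eqF // mulN1r subrr.
- move=> i l /setD1P[_ iW] /setD1P[lf lW].
  by rewrite rank1_mulE vY // [f == l]eq_sym (negbTE lf) mulr0 addr0 MY.
Qed.

(** Here [u] is the residual of index [k] after projection on the window: [u *m Y] vanishes on [W]
    and equals [s] at [k]. The rank-one term therefore leaves the columns of [M *m Y] in [W] alone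
    and adds [u] to column [k], which turns it into the unit vector. The sum formula for [s] is the
    one that the program evaluates. *)
Lemma window_inverse_border (R : realType) (n : nat) (Y M : 'M[R]_n)
    (W : {set 'I_n}) (k : 'I_n) (u := delta_mx 0 k - row k (Y *m M))
    (s := qform Y u) :
  posdef Y -> window_inverse Y W M -> k \notin W ->
  [/\ u 0 k = 1, forall i, i \notin k |: W -> u 0 i = 0,
      forall l, l \in W -> (u *m Y) 0 l = 0, 0 < s &
      s = Y k k - \sum_i Y k i * row k (Y *m M) 0 i /\
      window_inverse Y (k |: W) (M + s^-1 *: (u^T *m u))].
Proof.
move=> [symY posY] [symM M0 MY] kW.
have M0r i j : j \notin W -> M i j = 0 by move=> jW; rewrite -symM mxE M0.
have y0 i : i \notin W -> (Y *m M) k i = 0.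
  by move=> iW; rewrite mxE big1 // => j _; rewrite M0r ?mulr0.
have uE i : u 0 i = (i == k)%:R - (Y *m M) k i by rewrite !mxE eqxx.
have uk : u 0 k = 1 by rewrite uE eqxx y0 // subr0.
have u0 i : i \notin k |: W -> u 0 i = 0.
  by rewrite !inE negb_or => /andP[ik iW]; rewrite uE (negbTE ik) y0 // subr0.
have uYE l : (u *m Y) 0 l = Y k l - \sum_i Y k i * (M *m Y) i l.
  rewrite mulmxBl -rowE -row_mul -mulmxA.
  by rewrite !mxE.
have MY0 i l : i \notin W -> (M *m Y) i l = 0.
  by move=> iW; rewrite mxE big1 // => j _; rewrite M0 ?mul0r.
have uY0 l : l \in W -> (u *m Y) 0 l = 0.
  move=> lW; rewrite uYE (bigD1 l) //= MY // eqxx mulr1 big1 ?addr0 ?subrr //.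
  move=> i il; case: (boolP (i \in W)) => iW; last by rewrite MY0 ?mulr0.
  by rewrite MY // (negbTE il) mulr0.
have sE : s = (u *m Y) 0 k.
  rewrite /s qformE (bigD1 k) //= uk mulr1 big1 ?addr0 // => l lk.
  case: (boolP (l \in W)) => lW; first by rewrite uY0 ?mul0r.
  by rewrite u0 ?mulr0 // !inE negb_or lk.
have YM i : (Y *m M) k i = (M *m Y) i k.
  by rewrite -[in LHS]symY -[in LHS]symM -trmx_mul [LHS]mxE.
have s_gt0 : 0 < s.
  by apply: posY; apply/rV0Pn; exists k; rewrite uk oner_neq0.
split=> //; split.
  by rewrite sE uYE; congr (_ - _); apply: eq_bigr => i _; rewrite [row _ _ _ _]mxE YM.
split; first exact: rank1_sym.
  move=> i j iW; rewrite rank1E u0 // mulr0 mul0r addr0 M0 //.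
  by move: iW; rewrite !inE negb_or => /andP[].
move=> i l iW; rewrite rank1_mulE; case/setU1P => [->|lW].
  have -> : s^-1 * u 0 i * (u *m Y) 0 k = u 0 i.
    by rewrite -sE mulrAC mulVf ?mul1r ?gt_eqF.
  by rewrite uE YM addrCA subrr addr0.
rewrite uY0 // mulr0 addr0; case/setU1P: iW => [->|iW]; last exact: MY.
by rewrite MY0 //; case: eqP lW kW => // -> ->.
Qed.

(** * The maximum-determinant completion *)

(* The minimizer of u Y u^T among the vectors supported on {k - p, .., k}
   with u_k = 1. *)
Definition innovation_row (R : realType) (n : nat) (Y : 'M[R]_n) (p : nat)
    (k : 'I_n) (u : 'rV[R]_n) : Prop :=
  [/\ u 0 k = 1, forall i : 'I_n, ~~ (k - p <= i <= k)%N -> u 0 i = 0 &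
      forall i : 'I_n, (k - p <= i < k)%N -> (u *m Y) 0 i = 0].

(** Two indices in the support of [u] differ by at most [p], so only specified entries
    contribute. *)
Lemma qform_completion (R : realType) (n p : nat) (X : 'M[option R]_n)
    (Y Z : 'M[R]_n) (k : 'I_n) (u : 'rV[R]_n) :
  banded_pattern p X -> completion X Y -> completion X Z ->
  innovation_row Y p k u -> qform Z u = qform Y u.
Proof.
move=> bandX [_ XY] [_ XZ] [_ u0 _].
rewrite !qformE; apply: eq_bigr => l _; rewrite !mxE !big_distrl /=.
apply: eq_bigr => i _.
case: (boolP (k - p <= i <= k)%N) => iW; last by rewrite u0 ?mul0r.
case: (boolP (k - p <= l <= k)%N) => lW; last by rewrite (u0 l) ?mulr0.
have : isSome (X i l) by rewrite bandX; lia.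
by case E : (X i l) => [v|] // _; rewrite (XY _ _ _ E) (XZ _ _ _ E).
Qed.

Lemma maxdet_completion_of_rows (R : realType) (n p : nat) (X : 'M[option R]_n)
    (Y : 'M[R]_n) (u : 'I_n -> 'rV[R]_n) :
  banded_pattern p X -> pd_completion X Y ->
  (forall k, innovation_row Y p k (u k)) ->
  exists2 Z, maxdet_completion X Z & \det Z = \prod_k qform Y (u k).
Proof.
move=> bandX [XY pdY] urow.
pose U : 'M[R]_n := \matrix_k u k.
have UE k i : U k i = u k 0 i by rewrite mxE.
have detU : \det U = 1.
  rewrite det_trig; last first.
    apply/is_trig_mxP => k i ki; rewrite UE; have [_ -> //] := urow k; lia.
  by rewrite big1 // => k _; rewrite UE; have [-> _ _] := urow k.
have uU : U \in unitmx by rewrite unitmxE detU unitr1.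
have UZU Z k : (U *m Z *m U^T) k k = qform Z (u k).
  rewrite qformE mxE; apply: eq_bigr => l _; rewrite [U^T _ _]mxE UE.
  by congr (_ * _); rewrite -(rowK u k) -row_mul [RHS]mxE.
have detUZU Z : \det (U *m Z *m U^T) = \det Z.
  by rewrite !det_mulmx det_tr detU mul1r mulr1.
pose d : 'rV[R]_n := \row_k qform Y (u k).
have d_gt0 k : 0 < d 0 k.
  rewrite mxE -UZU; apply: posdef_diag_gt0; exact: posdef_congr.
pose V := invmx U.
have uV : V \in unitmx by rewrite unitmx_inv.
pose Z := V *m diag_mx d *m V^T.
have pdZ : posdef Z by apply: posdef_congr => //; exact: posdef_diag_mx.
have UZ : U *m Z *m U^T = diag_mx d.
  by rewrite /Z !mulmxA mulmxV // mul1mx -mulmxA -trmx_mul mulmxV // trmx1 mulmx1.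
have detZ : \det Z = \prod_k qform Y (u k).
  by rewrite -detUZU UZ det_diag; apply: eq_bigr => k _; rewrite mxE.
exists Z => //; split; last first.
  move=> Z' [XZ' pdZ']; rewrite detZ -detUZU.
  have /andP[_ /le_trans-> //] := hadamard_posdef (posdef_congr pdZ' uU).
  rewrite le_eqVlt; apply/orP; left; apply/eqP; apply: eq_bigr => k _.
  by rewrite UZU (qform_completion bandX XY XZ' (urow k)).
split=> //; split; first by case: pdZ.
have symZ : Z^T = Z by case: pdZ.
have symY : Y^T = Y by case: pdY.
(* U Z = diag(s) U^-T is lower triangular with diagonal s, and U Y agrees
   with it inside the band. *)
have UZE (k i : 'I_n) : (i <= k)%N -> (U *m Z) k i = (k == i)%:R * d 0 k.
  (* As [U] is lower unitriangular, entry [(k, i)] of [U *m Z *m U^T] is [(U *m Z) k i] plus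
     multiples of the [(U *m Z) k j] with [j < i], which vanish by induction. *)
  have [m] := ubnP (i : nat); elim: m i => // m IHm i im ik.
  have := congr1 (fun A : 'M_n => A k i) UZ; rewrite [RHS]mxE.
  rewrite mxE (bigD1 i) //= [U^T _ _]mxE UE; have [-> u0 _] := urow i.
  rewrite mulr1 big1 ?addr0 => [->|j ji]; first by rewrite mulr_natl.
  rewrite [U^T _ _]mxE UE.
  case: (ltnP j i) => ji'; last by rewrite u0 ?mulr0 //; move: ji; rewrite -val_eqE /=; lia.
  rewrite IHm; [|lia|lia].
  case: eqP => [kj|_]; last by rewrite !mul0r.
  by move: ji' ik; rewrite -kj; lia.
have uYE (k i : 'I_n) : (k - p <= i <= k)%N -> (u k *m Y) 0 i = (k == i)%:R * d 0 k.
  move=> ik; have [uk u0 uY0] := urow k.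
  case: eqP => [<-|ki]; last by rewrite mul0r uY0 //; move/eqP: ki; rewrite -val_eqE /=; lia.
  rewrite mul1r [d 0 k]mxE qformE (bigD1 k) //= uk mulr1 big1 ?addr0 // => l lk.
  case: (boolP (k - p <= l < k)%N) => lW; first by rewrite uY0 ?mul0r.
  by rewrite u0 ?mulr0 //; move: lk lW; rewrite -val_eqE /=; lia.
(* Row [u k] gives the same value on column [i] of [Z] and of [Y]; once the terms with [l < k] are
   known to agree, the coefficient 1 at [k] leaves the wanted entries. *)
have ukE (k i : 'I_n) : (k - p <= i <= k)%N ->
  (forall l : 'I_n, (k - p <= l < k)%N -> Z l i = Y l i) -> Z k i = Y k i.
  move=> ki ZYl; have [uk u0 _] := urow k.
  have : (U *m Z) k i = (u k *m Y) 0 i by rewrite uYE // UZE //; lia.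
  rewrite [LHS]mxE [RHS]mxE (bigD1 k) //= [RHS](bigD1 k) //= UE uk !mul1r.
  rewrite (eq_bigr (fun l => u k 0 l * Y l i)) => [/addIr //|l lk].
  rewrite UE; case: (boolP (k - p <= l < k)%N) => lW; first by rewrite ZYl.
  by rewrite u0 ?mul0r //; move: lk lW; rewrite -val_eqE /=; lia.
suff ZY (i j : 'I_n) : (j <= i)%N -> (i - j <= p)%N -> Z i j = Y i j.
  move=> i j v Xij.
  have : (`|i - j| <= p)%N by rewrite -bandX Xij.
  case: (leqP j i) => ij ijp.
    by rewrite ZY //; [case: XY => _; apply | lia].
  rewrite -symZ [LHS]mxE ZY; [|lia|lia].
  by rewrite -symY [LHS]mxE; case: XY => _; apply.
(* Strong induction on the row. The entries left of the diagonal come first, because the diagonal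
   entry needs column [i] above it, which is row [i] by symmetry. *)
have [m] := ubnP (i : nat); elim: m i j => // m IHm i j im ji ijp.
have ZYlt (l : 'I_n) : (l < i)%N -> (i - l <= p)%N -> Z i l = Y i l.
  move=> li ilp; apply: ukE => [|a aW]; first lia.
  case: (leqP l a) => la; first by apply: IHm; lia.
  by rewrite -symZ -symY [LHS]mxE [RHS]mxE; apply: IHm; lia.
case: (ltnP j i) => [ji'|ij]; first exact: ZYlt.
apply: ukE => [|a aW]; first lia.
have -> : j = i by apply: val_inj => /=; lia.
by rewrite -symZ -symY [LHS]mxE [RHS]mxE ZYlt //; lia.
Qed.

(** * Programs with cost bounds *)

(** Total correctness with a cost bound: a run exists only if every expression evaluated on the way
    is defined. The postcondition acts as a continuation, so sequencing is nesting. *)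
Definition runs (R : realType) (c : cmd) (s : state R) (b : nat)
    (Q : state R -> Prop) : Prop :=
  exists s' k, [/\ exec c s s' k, (k <= b)%N & Q s'].

Lemma runs_weaken (R : realType) (c : cmd) (s : state R) (b b' : nat)
    (Q Q' : state R -> Prop) :
  runs c s b Q -> (b <= b')%N -> (forall s', Q s' -> Q' s') -> runs c s b' Q'.
Proof.
move=> [s' [k [ex kb Qs']]] bb' QQ'; exists s', k; split=> //; last exact: QQ'.
exact: leq_trans bb'.
Qed.

Lemma runs_seq (R : realType) (c1 c2 : cmd) (s : state R) (b1 b2 : nat)
    (Q : state R -> Prop) :
  runs c1 s b1 (fun s1 => runs c2 s1 b2 Q) -> runs (Seq c1 c2) s (b1 + b2) Q.
Proof.
move=> [s1 [k1 [ex1 kb1 [s2 [k2 [ex2 kb2 Qs2]]]]]]; exists s2, (k1 + k2)%N.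
by split=> //; [exact: exec_seq ex1 ex2 | exact: leq_add].
Qed.

Lemma runs_iset (R : realType) (x : nat) (e : iexp) (s : state R)
    (Q : state R -> Prop) :
  Q (set_ivar s x (ieval s e)) -> runs (ISet x e) s 0 Q.
Proof. by move=> Qs; exists (set_ivar s x (ieval s e)), 0%N; split=> //; constructor. Qed.

Lemma runs_rset (R : realType) (a : nat) (i j : iexp) (e : rexp) (s : state R)
    (Q : state R -> Prop) :
  rdefined s e -> Q (set_arr s a (ieval s i) (ieval s j) (reval s e)) ->
  runs (RSet a i j e) s (rcost e) Q.
Proof. by move=> def_e Qs; eexists _, _; split; [exact: exec_rset| |]. Qed.

Lemma runs_if (R : realType) (t : test) (c1 c2 : cmd) (s : state R) (b : nat)
    (Q : state R -> Prop) :
  tdefined s t -> runs (if teval s t then c1 else c2) s b Q ->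
  runs (If t c1 c2) s (tcost t + b) Q.
Proof.
move=> def_t [s' [k [ex kb Qs']]]; exists s', (tcost t + k)%N.
by split=> //; [exact: exec_if | rewrite leq_add2l].
Qed.

(** The bound [hi] is exclusive: the test [x + 1 <= hi] expresses [x < hi]. *)
Definition For (x : nat) (lo hi : iexp) (c : cmd) : cmd :=
  Seq (ISet x lo)
    (While (ILe (IAdd (IVar x) (ILit 1)) hi)
       (Seq c (ISet x (IAdd (IVar x) (ILit 1))))).

(** Each pass pays for its body and one test, and the last 1 is the failing test. Since [hi] is
    evaluated again at every pass, the invariant has to fix its value along with the counter. *)
Lemma runs_for (R : realType) (x : nat) (lo hi : iexp) (c : cmd) (s : state R)
    (a b B : nat) (Inv : nat -> state R -> Prop) :
  ieval s lo = a -> (a <= b)%N -> Inv a (set_ivar s x a) ->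
  (forall m s1, Inv m s1 -> ivar s1 x = m /\ ieval s1 hi = b) ->
  (forall m s1, (a <= m < b)%N -> Inv m s1 ->
     runs c s1 B (fun s2 => Inv m.+1 (set_ivar s2 x (ivar s2 x + 1)))) ->
  runs (For x lo hi c) s ((b - a) * B.+1 + 1) (Inv b).
Proof.
move=> lo_a ab Inv_a Inv_x step.
suff loop d m s1 : (m + d)%N = b -> (a <= m)%N -> Inv m s1 ->
    runs (While (ILe (IAdd (IVar x) (ILit 1)) hi)
           (Seq c (ISet x (IAdd (IVar x) (ILit 1))))) s1 (d * B.+1 + 1) (Inv b).
  rewrite -[((b - a) * _ + 1)%N]add0n.
  by apply: runs_seq; apply: runs_iset; rewrite lo_a; apply: loop Inv_a; lia.
elim: d => [|d IHd] in m s1 * => mb am Inv_m; have [xm him] := Inv_x _ _ Inv_m.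
  exists s1, 1%N; split=> //; last by rewrite -mb addn0.
  by apply: exec_while_false => //=; rewrite xm him; lia.
have [||s2 [k [ex kB Inv2]]] := step m s1; [lia|by []|].
have [||s3 [k' [ex' kB' Inv3]]] := IHd m.+1 _ _ _ Inv2; [lia|lia|].
exists s3, (1 + (k + 0) + k')%N; split=> //; last by lia.
apply: (exec_while_true _ _ _ ex') => //=; first by rewrite xm him; lia.
by apply: exec_seq ex _; apply: exec_iset.
Qed.

(** Inner loops use counters with larger numbers, so a threshold suffices to say which variables
    survive a command. *)
Definition keeps_ivars (R : realType) (c : nat) (s s' : state R) : Prop :=
  forall x, (x < c)%N -> ivar s' x = ivar s x.

(** * The algorithm *)

(* Variable 2 is the current index k, variable 3 the start of the window, and
   variables 4 and 5 are loop counters.  Array 2 holds the window inverse, column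
   0 of array 3 the vector v and cell (0, 0) of array 4 the scalar a of the
   update M + v v^T / a. *)
Definition succ_k : iexp := IAdd (IVar 2) (ILit 1).

(** * Rank-one updates in place *)

Definition rank1_row_cmd : cmd :=
  For 5 (IVar 3) succ_k
    (RSet 2 (IVar 4) (IVar 5)
      (RAdd (RGet 2 (IVar 4) (IVar 5))
        (RDiv (RMul (RGet 3 (IVar 4) (ILit 0)) (RGet 3 (IVar 5) (ILit 0)))
           (RGet 4 (ILit 0) (ILit 0))))).

Definition rank1_cmd : cmd := For 4 (IVar 3) succ_k rank1_row_cmd.

(** The factor 4 counts three arithmetic operations and one test. Working in place is safe because
    an update reads no cell of array 2 but its own. *)
Lemma runs_rank1_row (R : realType) (s : state R) (lo k i : nat) :
  ivar s 2 = k -> ivar s 3 = lo -> ivar s 4 = i -> (lo <= k)%N ->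
  arr s 4 0 0 != 0 ->
  runs rank1_row_cmd s ((k.+1 - lo) * 4 + 1) (fun s' =>
    keeps_ivars 5 s s' /\
    forall a i' j, arr s' a i' j =
      if [&& a == 2, i' == i & lo <= j < k.+1]%N
      then arr s 2 i' j + arr s 3 i' 0 * arr s 3 j 0 / arr s 4 0 0
      else arr s a i' j).
Proof.
move=> sk slo si lok s0.
pose Inv m s' := [/\ keeps_ivars 5 s s', ivar s' 5 = m &
    forall a i' j, arr s' a i' j =
      if [&& a == 2, i' == i & lo <= j < m]%N
      then arr s 2 i' j + arr s 3 i' 0 * arr s 3 j 0 / arr s 4 0 0
      else arr s a i' j].
apply: runs_weaken (_ : runs _ _ _ (Inv k.+1)) _ _; [|exact: leqnn|by move=> s' []].
apply: runs_for => //=; first lia.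
- split=> //; first by move=> x /=; case: eqP => //; lia.
  by move=> a i' j /=; case: ifP => //; lia.
- by move=> m s1 [ks s5 _]; rewrite s5 ks // sk addn1.
move=> m s1 mk [ks s5 sarr].
apply: runs_rset => /=.
  by rewrite sarr.
rewrite s5 !ks // si !sarr /= ltnn !andbF.
split=> /=.
- by move=> x x5 /=; case: eqP => [|_]; [lia|exact: ks].
- by rewrite addn1.
move=> a i' j; rewrite sarr.
case: ifP => [/and3P[/eqP-> /eqP-> /eqP->]|].
  by have -> : [&& 2 == 2, i == i & lo <= m < m.+1]%N by lia.
by move=> h; case: ifP => h'; case: ifP => h'' //; lia.
Qed.

Lemma runs_rank1 (R : realType) (s : state R) (lo k : nat) :
  ivar s 2 = k -> ivar s 3 = lo -> (lo <= k)%N -> arr s 4 0 0 != 0 ->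
  runs rank1_cmd s ((k.+1 - lo) * ((k.+1 - lo) * 4 + 2) + 1) (fun s' =>
    keeps_ivars 4 s s' /\
    forall a i j, arr s' a i j =
      if [&& a == 2, lo <= i < k.+1 & lo <= j < k.+1]%N
      then arr s 2 i j + arr s 3 i 0 * arr s 3 j 0 / arr s 4 0 0
      else arr s a i j).
Proof.
move=> sk slo lok s0.
pose Inv m s' := [/\ keeps_ivars 4 s s', ivar s' 4 = m &
    forall a i j, arr s' a i j =
      if [&& a == 2, lo <= i < m & lo <= j < k.+1]%N
      then arr s 2 i j + arr s 3 i 0 * arr s 3 j 0 / arr s 4 0 0
      else arr s a i j].
rewrite [(_ + 2)%N]addnS.
apply: runs_weaken (_ : runs _ _ _ (Inv k.+1)) _ _; [|exact: leqnn|by move=> s' []].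
apply: runs_for => //=; first lia.
- split=> //; first by move=> x /=; case: eqP => //; lia.
  by move=> a i j /=; case: ifP => //; lia.
- by move=> m s1 [ks s4 _]; rewrite s4 ks // sk addn1.
move=> m s1 mk [ks s4 sarr].
apply: runs_weaken (runs_rank1_row (lo := lo) (k := k) (i := m) _ _ _ _ _) _ _ => //.
- by rewrite ks.
- by rewrite ks.
- by rewrite sarr.
move=> s' [ks' sarr']; split=> /=.
- move=> x x4 /=; case: eqP => [|_]; first lia.
  by rewrite ks' ?ks //; lia.
- by rewrite ks' // s4 addn1.
move=> a i j; rewrite sarr' !sarr /=.
case: (boolP [&& a == 2%N, i == m & (lo <= j < k.+1)%N]) => [|h].
  case/and3P=> /eqP-> /eqP-> jk.
  by rewrite ltnn !andbF jk; have -> : (lo <= m < m.+1)%N by lia.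
by case: ifP => h'; case: ifP => h'' //; lia.
Qed.

(** * The projection on the window and the scalar s_k *)

Definition dot_cmd : cmd :=
  For 5 (IVar 3) (IVar 2)
    (RSet 3 (IVar 4) (ILit 0)
      (RAdd (RGet 3 (IVar 4) (ILit 0))
        (RMul (RGet 2 (IVar 4) (IVar 5)) (RGet 0 (IVar 5) (IVar 2))))).

Lemma runs_dot (R : realType) (s : state R) (lo k i : nat) :
  ivar s 2 = k -> ivar s 3 = lo -> ivar s 4 = i -> (lo <= k)%N ->
  runs dot_cmd s ((k - lo) * 3 + 1) (fun s' =>
    keeps_ivars 5 s s' /\
    forall a i' j, arr s' a i' j =
      if [&& a == 3, i' == i & j == 0]%N
      then arr s 3 i 0 + \sum_(lo <= l < k) arr s 2 i l * arr s 0 l k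
      else arr s a i' j).
Proof.
move=> sk slo si lok.
pose Inv m s' := [/\ keeps_ivars 5 s s', ivar s' 5 = m &
    forall a i' j, arr s' a i' j =
      if [&& a == 3, i' == i & j == 0]%N
      then arr s 3 i 0 + \sum_(lo <= l < m) arr s 2 i l * arr s 0 l k
      else arr s a i' j].
apply: runs_weaken (_ : runs _ _ _ (Inv k)) _ _; [|exact: leqnn|by move=> s' []].
apply: runs_for => //=.
- split=> //; first by move=> x /=; case: eqP => //; lia.
  move=> a i' j /=; case: ifP => // /and3P[/eqP-> /eqP-> /eqP->].
  by rewrite big_geq ?addr0.
- by move=> m s1 [ks s5 _]; rewrite s5 ks.
move=> m s1 mk [ks s5 sarr].
apply: runs_rset => //=.
rewrite s5 !ks // si sk !sarr /= !eqxx /=.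
split=> /=.
- by move=> x x5 /=; case: eqP => [|_]; [lia|exact: ks].
- by rewrite addn1.
move=> a i' j; rewrite sarr.
case: (boolP [&& a == 3%N, i' == i & j == 0%N]) => // _.
by rewrite big_nat_recr /= ?addrA //; lia.
Qed.

(** With x the window part of column k, array 3 receives y = M x, and the scalar in array 4
    decreases from X_kk to X_kk - x^T y. *)
Definition innovation_cmd : cmd :=
  Seq (RSet 4 (ILit 0) (ILit 0) (RGet 0 (IVar 2) (IVar 2)))
    (For 4 (IVar 3) (IVar 2)
      (Seq (RSet 3 (IVar 4) (ILit 0) (RLit 0))
        (Seq dot_cmd
          (RSet 4 (ILit 0) (ILit 0)
            (RSub (RGet 4 (ILit 0) (ILit 0))
              (RMul (RGet 3 (IVar 4) (ILit 0)) (RGet 0 (IVar 4) (IVar 2)))))))).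

Lemma runs_innovation (R : realType) (s : state R) (lo k : nat)
    (y := fun i => \sum_(lo <= l < k) arr s 2 i l * arr s 0 l k) :
  ivar s 2 = k -> ivar s 3 = lo -> (lo <= k)%N ->
  runs innovation_cmd s ((k - lo) * ((k - lo) * 3 + 4) + 1) (fun s' =>
    [/\ keeps_ivars 4 s s',
        forall a i j, a \notin [:: 3; 4]%N -> arr s' a i j = arr s a i j,
        forall i, (lo <= i < k)%N -> arr s' 3 i 0 = y i &
        arr s' 4 0 0 = arr s 0 k k - \sum_(lo <= i < k) y i * arr s 0 i k]).
Proof.
move=> sk slo lok.
pose Inv m s' := [/\ keeps_ivars 4 s s' /\ ivar s' 4 = m,
    forall a i j, a \notin [:: 3; 4]%N -> arr s' a i j = arr s a i j,
    forall i, (lo <= i < m)%N -> arr s' 3 i 0 = y i &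
    arr s' 4 0 0 = arr s 0 k k - \sum_(lo <= i < m) y i * arr s 0 i k].
apply: runs_weaken (_ : runs _ _ (0 + _) (Inv k)) _ _;
  [|rewrite add0n; exact: leqnn|by move=> s' [[]]].
apply: runs_seq; apply: runs_rset => //=.
rewrite [(_ + 4)%N]addnS.
apply: runs_for => //=.
- split=> /=; last by rewrite sk big_geq ?subr0.
  + by split=> // x /=; case: eqP => //; lia.
  + by move=> a i j; case: eqP => // ->.
  + by move=> i; lia.
- by move=> m s1 [[ks s4] _ _ _]; rewrite s4 ks.
move=> m s1 mk [[ks s4] sarr sy ss].
(* The body splits into a free reset, the dot product, and one multiplication with one
   subtraction. *)
rewrite [(_ + 3)%N](_ : _ = 0 + (((k - lo) * 3 + 1) + 2))%N; last by rewrite add0n -addnA.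
apply: runs_seq; apply: runs_rset => //=; apply: runs_seq.
apply: runs_weaken (runs_dot (lo := lo) (k := k) (i := m) _ _ _ _) (leqnn _) _ => //=;
  try by rewrite ks.
move=> s2 [ks2 sarr2].
apply: runs_rset => //=.
rewrite !ks2 //= !sarr2 /= !s4 ks // sk !eqxx /=.
rewrite (eq_bigr (fun l => arr s 2 m l * arr s 0 l k)); last first.
  by move=> l _; rewrite !sarr.
rewrite -/(y m) add0r.
split=> /=.
- split; last by rewrite addn1.
  move=> x x4 /=; case: eqP => [|_]; first lia.
  by rewrite ks2 /= ?ks //; lia.
- move=> a i j a34; move: (a34); rewrite !inE negb_or => /andP[/negbTE a3 /negbTE a4].
  by rewrite a4 sarr2 a3 /= ?a3 sarr.
- move=> i im; rewrite sarr2 /= s4 andbT; case: eqP => [->|nim].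
    by rewrite !eqxx add0r; apply: eq_bigr => l _; rewrite !sarr.
  by rewrite sy //; lia.
- by rewrite ss big_nat_recr /= ?opprD ?addrA ?sarr //; lia.
Qed.

(** Row [lo] is saved first because the rank-one update that removes index [lo] overwrites it. *)
Definition copy_cmd : cmd :=
  For 4 (IVar 3) succ_k (RSet 3 (IVar 4) (ILit 0) (RGet 2 (IVar 3) (IVar 4))).

Lemma runs_copy (R : realType) (s : state R) (lo k : nat) :
  ivar s 2 = k -> ivar s 3 = lo -> (lo <= k)%N ->
  runs copy_cmd s ((k.+1 - lo) * 1 + 1) (fun s' =>
    [/\ keeps_ivars 4 s s',
        forall a i j, a != 3%N -> arr s' a i j = arr s a i j &
        forall i, (lo <= i < k.+1)%N -> arr s' 3 i 0 = arr s 2 lo i]).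
Proof.
move=> sk slo lok.
pose Inv m s' := [/\ keeps_ivars 4 s s', ivar s' 4 = m,
    forall a i j, a != 3%N -> arr s' a i j = arr s a i j &
    forall i, (lo <= i < m)%N -> arr s' 3 i 0 = arr s 2 lo i].
apply: runs_weaken (_ : runs _ _ _ (Inv k.+1)) _ _; [|exact: leqnn|by move=> s' []].
apply: runs_for => //=; first lia.
- split=> //; last by move=> i; lia.
  by move=> x /=; case: eqP => //; lia.
- by move=> m s1 [ks s4 _ _]; rewrite s4 ks // sk addn1.
move=> m s1 mk [ks s4 sarr sy].
apply: runs_rset => //=; split=> /=.
- by move=> x x4 /=; case: eqP => [|_]; [lia|exact: ks].
- by rewrite s4 addn1.
- by move=> a i j a3; rewrite /= (negbTE a3) /= sarr.
- move=> i im; rewrite s4 andbT ks // slo.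
  by case: eqP => [->|nim]; [rewrite sarr | rewrite sy //; lia].
Qed.

(** * Sliding windows and the loop invariant *)

Lemma sum_nat_ord (R : realType) (n lo k : nat) (F : nat -> R) (G : 'I_n -> R) :
  (k <= n)%N -> (forall i : 'I_n, (lo <= i < k)%N -> F i = G i) ->
  (forall i : 'I_n, ~~ (lo <= i < k)%N -> G i = 0) ->
  \sum_(lo <= i < k) F i = \sum_i G i.
Proof.
move=> kn FG G0; rewrite (big_nat_widen _ _ n) // big_geq_mkord big_mkcond /=.
apply: eq_bigr => i _; case: ifP => ik; first by apply: FG; lia.
by rewrite G0 //; lia.
Qed.

(** Truncated subtraction makes this the whole prefix while [k <= p], so the window grows for
    [k < p] and slides afterwards. *)
Definition window (n p k : nat) : {set 'I_n} := [set i : 'I_n | (k - p <= i < k)%N].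

Lemma window_grow (n p : nat) (k : 'I_n) :
  (k < p)%N -> k |: window n p k = window n p k.+1.
Proof. by move=> kp; apply/setP => i; rewrite !inE -val_eqE /=; lia. Qed.

Lemma window_slide (n p : nat) (k f : 'I_n) :
  (1 <= p <= k)%N -> f = (k - p)%N :> nat ->
  (k |: window n p k) :\ f = window n p k.+1.
Proof. by move=> pk fE; apply/setP => i; rewrite !inE -!val_eqE /= fE; lia. Qed.

Lemma input_entryE (R : realType) (n p : nat) (X : 'M[option R]_n)
    (Y : 'M[R]_n) (i j : 'I_n) :
  banded_pattern p X -> completion X Y -> (`|i - j| <= p)%N ->
  input_entry X i j = Y i j.
Proof.
move=> bandX [_ XY] ijp; rewrite /input_entry !valK.
have : isSome (X i j) by rewrite bandX.
by case E : (X i j) => [v|] // _; rewrite (XY _ _ _ E).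
Qed.

(** The rows [u] are ghost data: the program keeps only the sum of logarithms, while the rows link
    that sum to the optimal completion. *)
Definition loop_inv (R : realType) (n p : nat) (X : 'M[option R]_n)
    (Y : 'M[R]_n) (k : nat) (s : state R) : Prop :=
  [/\ [/\ ivar s 0 = n, ivar s 1 = p & ivar s 2 = k],
      forall i j, arr s 0 i j = input_entry X i j,
      exists2 M, window_inverse Y (window n p k) M &
        forall i j : 'I_n, arr s 2 i j = M i j &
      exists2 u : 'I_n -> 'rV[R]_n,
        forall i : 'I_n, (i < k)%N -> innovation_row Y p i (u i) &
        arr s 1 0 0 = \sum_(i < n | (i < k)%N) ln (qform Y (u i))].

(** Storing [- M f f] as the scalar turns the additive update into the subtraction required for
    removal. *)
Definition remove_cmd : cmd :=
  Seq copy_cmd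
    (Seq (RSet 4 (ILit 0) (ILit 0) (RSub (RLit 0) (RGet 2 (IVar 3) (IVar 3))))
       rank1_cmd).

(** Putting -1 at index [k] next to y in array 3 yields the negated residual; its sign cancels in
    the rank-one product, so y need not be negated. *)
Definition step_cmd : cmd :=
  Seq (ISet 3 (ISub (IVar 2) (IVar 1)))
    (Seq innovation_cmd
      (Seq (RSet 1 (ILit 0) (ILit 0)
              (RAdd (RGet 1 (ILit 0) (ILit 0)) (RLn (RGet 4 (ILit 0) (ILit 0)))))
        (Seq (RSet 3 (IVar 2) (ILit 0) (RSub (RLit 0) (RLit 1)))
          (Seq rank1_cmd (If (ILe (IVar 1) (IVar 2)) remove_cmd Skip))))).

Lemma runs_remove (R : realType) (s : state R) (lo k : nat) :
  ivar s 2 = k -> ivar s 3 = lo -> (lo <= k)%N -> arr s 2 lo lo != 0 ->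
  runs remove_cmd s
    ((k.+1 - lo) * 1 + 1 + (1 + ((k.+1 - lo) * ((k.+1 - lo) * 4 + 2) + 1)))
    (fun s' =>
    [/\ keeps_ivars 3 s s',
        forall a i j, (a < 2)%N -> arr s' a i j = arr s a i j &
        forall i j, arr s' 2 i j =
          if (lo <= i < k.+1)%N && (lo <= j < k.+1)%N
          then arr s 2 i j - arr s 2 lo i * arr s 2 lo j / arr s 2 lo lo
          else arr s 2 i j]).
Proof.
move=> sk slo lok nz.
apply: runs_seq; apply: runs_weaken (runs_copy sk slo lok) (leqnn _) _.
move=> s1 [ks1 sarr1 sy1].
apply: runs_seq; apply: runs_rset => //=.
rewrite ks1 // slo sarr1 // sub0r.
apply: runs_weaken (runs_rank1 (lo := lo) (k := k) _ _ _ _) (leqnn _) _ => //=.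
- by rewrite ks1.
- by rewrite ks1.
- by rewrite oppr_eq0.
move=> s2 [ks2 sarr2]; split.
- by move=> x x3; rewrite ks2 /= ?ks1 //; lia.
- move=> a i j a2; rewrite sarr2 /=.
  have [-> -> a3] : [/\ (a == 2%N) = false, (a == 4%N) = false & a != 3%N] by split; lia.
  by rewrite /= sarr1.
- move=> i j; rewrite sarr2 /= ![arr s1 2 _ _]sarr1 //.
  case: ifP => // /andP[iW jW].
  by rewrite !sy1 // invrN mulrN.
Qed.

Lemma runs_step (R : realType) (n p : nat) (X : 'M[option R]_n) (Y : 'M[R]_n)
    (k : nat) (s : state R) :
  (1 <= p)%N -> (k < n)%N -> banded_pattern p X -> pd_completion X Y ->
  loop_inv p X Y k s ->
  runs step_cmd s (100 * p ^ 2)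
    (fun s' => loop_inv p X Y k.+1 (set_ivar s' 2 (ivar s' 2 + 1))).
Proof.
move=> p_gt0 kn bandX [XY pdY] [[sn sp sk] sX [M winM sM] [u urow sacc]].
pose K := Ordinal kn; pose lo := (k - p)%N.
have [symM M0 _] := winM.
have Ysym i j : Y i j = Y j i by case: pdY => symY _; rewrite -[in LHS]symY mxE.
have sYX (i j : 'I_n) : (`|i - j| <= p)%N -> arr s 0 i j = Y i j.
  by move=> ijp; rewrite sX (input_entryE bandX XY).
have KW : K \notin window n p k by rewrite inE /=; lia.
have [] := window_inverse_border pdY winM KW.
set v := _ - _; set q := qform Y v => vK v0 vY q_gt0 [qE winM1].
set M1 := _ + _ in winM1.
have vrow : innovation_row Y p K v.
  split=> // i iW; last by rewrite vY // inE.
  by rewrite v0 // !inE -val_eqE /=; move: iW => /=; lia.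
have lok : (lo <= k)%N by rewrite leq_subr.
have wp : (k.+1 - lo <= p.+1)%N by rewrite /lo; lia.
set w := (k.+1 - lo)%N in wp.
pose brank := (w * (w * 4 + 2) + 1)%N.
pose binno := ((k - lo) * ((k - lo) * 3 + 4) + 1)%N.
(* In order: the innovation, the addition with its logarithm, the entry -1, bordering, the test, and
   the removal. As [w <= p + 1], the total is at most 11 p^2 + 25 p + 22, well below 100 p^2 for
   [1 <= p]. *)
pose b := (0 + (binno + (2 + (1 + (brank + (1 + (w * 1 + 1 + (1 + brank))))))))%N.
apply: (runs_weaken (b := b)) => [||s' Hs']; [|rewrite /b /brank /binno; nia|exact: Hs'].
apply: runs_seq; apply: runs_iset; rewrite /= sk sp -/lo.
apply: runs_seq.
apply: runs_weaken (runs_innovation (lo := lo) (k := k) _ _ _) (leqnn _) _ => //=.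
move=> s1 [ks1 sarr1].
pose y i := \sum_(lo <= l < k) arr s 2 i l * arr s 0 l k.
move=> sy sq.
have sy1 i : (lo <= i < k)%N -> arr s1 3 i 0 = y i by exact: sy.
have sq1 : arr s1 4 0 0 = arr s 0 k k - \sum_(lo <= i < k) y i * arr s 0 i k.
  exact: sq.
clear sy sq.
have M0r i j : j \notin window n p k -> M i j = 0.
  by move=> jW; rewrite -symM mxE M0.
have YM0 (i : 'I_n) : ~~ (lo <= i < k)%N -> (Y *m M) K i = 0.
  by move=> iW; rewrite mxE big1 // => l _; rewrite M0r ?mulr0 // inE.
have vE i : v 0 i = (i == K)%:R - (Y *m M) K i by rewrite !mxE eqxx.
(* The dot products read X only at distance at most [p] from the diagonal, where it agrees with
   [Y]. *)
have yE (i : 'I_n) : y i = (Y *m M) K i.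
  rewrite mxE; apply: sum_nat_ord => [|l lk|l lk]; first exact: ltnW.
    rewrite sM (sYX l K) /=; last by move: lk; rewrite /lo; lia.
    by rewrite Ysym -[in LHS]symM mxE mulrC.
  by rewrite M0 ?mulr0 // inE.
have {}sq1 : arr s1 4 0 0 = q.
  rewrite sq1 qE (sYX K K) /=; last lia.
  congr (_ - _); apply: sum_nat_ord => [|l lk|l lk]; first exact: ltnW.
    rewrite yE (sYX l K) /=; last by move: lk; rewrite /lo; lia.
    by rewrite Ysym [row _ _ _ _]mxE mulrC.
  by rewrite [row _ _ _ _]mxE YM0 ?mulr0.
apply: runs_seq; apply: runs_rset => /=; first by rewrite sq1.
apply: runs_seq; apply: runs_rset => //=.
rewrite ks1 //= sk sarr1 // sq1.
apply: runs_seq.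
apply: runs_weaken (runs_rank1 (lo := lo) (k := k) _ _ _ _) (leqnn _) _ => //=.
- by rewrite ks1.
- by rewrite ks1.
- by rewrite sq1 gt_eqF.
move=> s2 [ks2 sarr2].
(* Array 3 holds [- v], whose sign cancels. Cells outside the updated square also agree with [M1],
   since [v] vanishes outside [lo .. k]. *)
have s2M (i j : 'I_n) : arr s2 2 i j = M1 i j.
  have v3 (i' : 'I_n) : (lo <= i' < k.+1)%N ->
      (if (i' : nat) == k then 0 - 1 else arr s1 3 i' 0) = - v 0 i'.
    move=> iW; rewrite vE -val_eqE /=; case: eqP => ik.
      by rewrite YM0 /= ?ik ?ltnn ?andbF // subr0 sub0r.
    by rewrite sy1 ?yE ?sub0r ?opprK //; lia.
  have v3' (i' : 'I_n) : ~~ (lo <= i' < k.+1)%N -> v 0 i' = 0.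
    by move=> iW; have [_ -> //] := vrow.
  rewrite rank1E sarr2 /= sq1 !eqxx !andbT.
  case: ifP => [/andP[iW jW]|/negbT].
    by rewrite !v3 // sarr1 //= sM mulrNN mulrC mulrA.
  rewrite negb_and => /orP[]/v3'->;
    by rewrite ?mulr0 ?mul0r addr0 sarr1 // sM.
(* Shared by both branches of the final test, which differ only in how they obtain the next window
   inverse. *)
have post s' : keeps_ivars 3 s2 s' ->
    (forall a i j, (a < 2)%N -> arr s' a i j = arr s2 a i j) ->
    (exists2 M', window_inverse Y (window n p k.+1) M' &
       forall i j : 'I_n, arr s' 2 i j = M' i j) ->
    loop_inv p X Y k.+1 (set_ivar s' 2 (ivar s' 2 + 1)).
  move=> ks' sarr' invM'; split=> //=.
  - by rewrite !ks' // !ks2 //= !ks1 //= sn sp sk addn1.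
  - by move=> i j; rewrite sarr' // sarr2 /= sarr1.
  exists (fun i => if i == K then v else u i).
    move=> i; rewrite ltnS leq_eqVlt -[i == K]val_eqE /=.
    case: eqP => [ik|_] /=; last exact: urow.
    by have -> : i = K by apply: val_inj.
  rewrite sarr' // sarr2 /= sacc [RHS](bigD1 K) //= eqxx -/q addrC; congr (_ + _).
  apply: eq_big => [i|i ik]; first by rewrite -val_eqE /=; lia.
  by rewrite -val_eqE /= ltn_eqF.
have := runs_if (t := ILe (IVar 1) (IVar 2)); apply => //=.
have -> : ivar s2 1 = p by rewrite ks2 //= ks1.
have -> : ivar s2 2 = k by rewrite ks2 //= ks1.
case: (leqP p k) => [pk|kp]; last first.
  exists s2, 0%N; split; [exact: exec_skip|exact: leq0n|].
  by apply: post => //; exists M1; rewrite // -(window_grow (k := K)).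
have lon : (lo < n)%N by rewrite (leq_ltn_trans _ kn).
pose f := Ordinal lon.
have fW : f \in K |: window n p k by rewrite !inE -val_eqE /= /lo; lia.
have [Mff_gt0 winM2] := window_inverse_remove pdY winM1 fW.
have s2f (j : 'I_n) : arr s2 2 lo j = M1 f j by exact: (s2M f j).
have s2ff : arr s2 2 lo lo = M1 f f by exact: (s2M f f).
apply: runs_weaken (runs_remove (lo := lo) (k := k) _ _ _ _) (leqnn _) _ => //=.
- by rewrite ks2 //= ks1.
- by rewrite ks2 //= ks1.
- by rewrite s2ff gt_eqF.
move=> s3 [ks3 sarr3 s3M]; apply: post => //.
rewrite (window_slide (p := p)) ?p_gt0 // in winM2.
eexists; first exact: winM2.
move=> i j; rewrite s3M s2ff !s2f s2M.
have [symM1 M10 _] := winM1.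
rewrite -scaleNr [RHS]rank1E ![row _ _ _ _]mxE.
case: ifP => [_|/negbT]; first by rewrite mulNr mulNr mulrC mulrA.
have Mf0 (i' : 'I_n) : ~~ (lo <= i' < k.+1)%N -> M1 f i' = 0.
  by move=> iW; rewrite -symM1 mxE M10 // !inE -val_eqE /= -/lo; lia.
by rewrite negb_and => /orP[]/Mf0->; rewrite ?mulr0 ?mul0r addr0.
Qed.

(** * The whole run *)

Definition main_cmd : cmd := For 2 (ILit 0) (IVar 0) step_cmd.

Lemma ln_prod (R : realType) (n : nat) (F : 'I_n -> R) :
  (forall i, 0 < F i) -> ln (\prod_i F i) = \sum_i ln (F i).
Proof.
(* Positivity is carried through the induction because [lnM] requires positive factors. *)
move=> F_gt0; suff [_ ->] : 0 < \prod_i F i /\ ln (\prod_i F i) = \sum_i ln (F i) by [].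
elim/big_ind2: _ => [|x1 y1 x2 y2 [x1_gt0 <-] [x2_gt0 <-]|i _] //; first by rewrite ln1.
by rewrite mulr_gt0 // lnM.
Qed.

Lemma runs_main (R : realType) (n p : nat) (X : 'M[option R]_n) (Y : 'M[R]_n) :
  (1 <= p)%N -> (p < n)%N -> banded_pattern p X -> pd_completion X Y ->
  runs main_cmd (init_state p X) (102 * (n * p ^ 2)) (loop_inv p X Y n).
Proof.
move=> p_gt0 pn bandX compY.
(* The n loop tests and the final failing test each fit into one further n p^2, whence 102. *)
have cost : ((n - 0) * (100 * p ^ 2).+1 + 1 <= 102 * (n * p ^ 2))%N.
  have : (0 < p ^ 2)%N by rewrite expn_gt0 p_gt0.
  by move: (p ^ 2)%N => P /(leq_pmulr n); rewrite subn0; lia.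
apply: runs_weaken cost (fun _ => id).
apply: runs_for => //=.
(* At [k = 0] the window is empty, and the zero-initialized array 2 represents its inverse. *)
- split=> //=.
    exists 0 => [|i j]; last by rewrite mxE.
    split; first by rewrite trmx0.
      by move=> i j _; rewrite mxE.
    by move=> i l; rewrite inE ltn0 andbF.
  by exists (fun=> 0) => //; rewrite big1.
- by move=> m s1 [[-> _ ->]].
by move=> m s1 mn inv; apply: runs_step.
Qed.

Theorem mainTheorem2 :
  exists (c : cmd) (C : nat),
    forall (R : realType) (n p : nat) (X : 'M[option R]_n),
      (1 <= p)%N -> (p < n)%N ->
      partial_symmetric X -> banded_pattern p X ->
      (exists Y : 'M[R]_n, pd_completion X Y) ->
      exists (Xhat : 'M[R]_n) (k : nat),
        maxdet_completion X Xhat /\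
        computes c p X (ln (\det Xhat)) k /\
        (k <= C * (n * p ^ 2))%N.
Proof.
exists main_cmd, 102%N => R n p X p_gt0 pn _ bandX [Y compY].
have [s [k [ex kb [_ _ _ [u urow sacc]]]]] := runs_main p_gt0 pn bandX compY.
have {}urow i : innovation_row Y p i (u i) by exact: urow.
have [Z maxZ detZ] := maxdet_completion_of_rows bandX compY urow.
exists Z, k; split=> //; split=> //; exists s; split=> //.
rewrite sacc detZ ln_prod; first by apply: eq_bigl => i; rewrite ltn_ord.
(* Each factor is positive because [u i] has entry 1 at [i] and is therefore nonzero. *)
move=> i; have [_ [_]] := compY; apply; apply/rV0Pn; exists i.
by have [-> _ _] := urow i; rewrite oner_neq0.
Qed.
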